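(* Let $G$ be a finite Hamiltonian group, that is, $G$ is a finite non-abelian group in which every subgroup is normal. Then $G$ is not saturated.
   Context: A $G$ transfer system $\mathcal{T}$ ($G$ a finite group) is a partial order $\to_{\mathcal{T}}$ on the set of subgroups of $G$ such that: $K\to_{\mathcal{T}}H$ implies $K\le H$; if $L\to_{\mathcal{T}}H$ and $K\le H$ then $K\cap L\to_{\mathcal{T}}K$; if $K\to_{\mathcal{T}}H$ and $g\in G$ then $gKg^{-1}\to_{\mathcal{T}}gHg^{-1}$. A transfer system $\mathcal{T}$ is saturated if whenever $L\le K\le H\le G$ and $L\to_{\mathcal{T}}H$, then $K\to_{\mathcal{T}}H$. A $G$-universe $\mathcal{U}$ is a countably infinite-dimensional real orthogonal $G$-representation which contains a non-zero subrepresentation on which $G$ acts trivially, and such that for every finite-dimensional subrepresentation $V\subset\mathcal{U}$ and every $n$, $V^{\oplus n}$ embeds in $\mathcal{U}$. The transfer system $\mathcal{T}_{\mathcal{L}(\mathcal{U})}$ (associated with the linear isometries operad) is given, for $K\le H\le G$, by: $K\to_{\mathcal{L}(\mathcal{U})}H$ iff $\mathrm{ind}^H_K\mathrm{res}^G_K\mathcal{U}$ embeds ($H$-equivariantly and linearly) into $\mathrm{res}^G_H\mathcal{U}$. A finite group $G$ is saturated if for each saturated $G$ transfer system $\mathcal{T}$ there exists a $G$-universe $\mathcal{U}$ with $\mathcal{T}=\mathcal{T}_{\mathcal{L}(\mathcal{U})}$. *)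

(* Defs.v *)
From HB Require Import structures.
From mathcomp Require Import all_boot all_order all_algebra all_fingroup.
From mathcomp Require Import reals.

Set Implicit Arguments.
Unset Strict Implicit.
Unset Printing Implicit Defensive.

Import Order.TTheory GRing.Theory Num.Theory.
Local Open Scope ring_scope.

Section TransferSystems.
Variables (gT : finGroupType) (G : {group gT}).

(* A relation on the subgroups of [G] is given by a relation on all groups of
   [gT], of which only the restriction to subgroups of [G] is ever used.
   In MathComp, [H :^ x] is x^-1 H x, so g H g^-1 is [H :^ g^-1]. *)
Record transfer_system (T : {group gT} -> {group gT} -> Prop) : Prop :=
  TransferSystem {
    transfer_refl : forall H : {group gT}, H \subset G -> T H H;
    transfer_anti : forall H K : {group gT}, H \subset G -> K \subset G ->
      T H K -> T K H -> H = K;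
    transfer_trans : forall K H L : {group gT},
      K \subset G -> H \subset G -> L \subset G -> T K H -> T H L -> T K L;
    transfer_sub : forall K H : {group gT}, K \subset G -> H \subset G ->
      T K H -> K \subset H;
    transfer_restr : forall L H K : {group gT},
      L \subset G -> H \subset G -> K \subset G ->
      T L H -> K \subset H -> T (K :&: L)%G K;
    transfer_conj : forall (K H : {group gT}) (g : gT),
      K \subset G -> H \subset G -> g \in G ->
      T K H -> T (K :^ g^-1)%G (H :^ g^-1)%G
  }.

Definition saturated_transfer (T : {group gT} -> {group gT} -> Prop) : Prop :=
  forall L K H : {group gT},
    L \subset K -> K \subset H -> H \subset G -> T L H -> T K H.

Definition hamiltonian : Prop :=
  ~~ abelian G /\ (forall H : {group gT}, H \subset G -> (H <| G)%g).

End TransferSystems.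

(* As for [mx_representation], the values of [repr_fun] outside [G] are
   irrelevant; [V] may be infinite-dimensional. *)
Record representation (R : nzRingType) (gT : finGroupType) (G : {set gT})
    (V : lmodType R) := Representation {
  repr_fun :> gT -> V -> V;
  repr_linear : {in G, forall g, linear (repr_fun g)};
  repr_fun1 : forall v, repr_fun 1%g v = v;
  repr_funM : {in G &, forall g h, forall v,
    repr_fun (g * h)%g v = repr_fun g (repr_fun h v)}
}.

Definition embeds (R : nzRingType) (gT : finGroupType) (G : {set gT})
    (V W : lmodType R) (rV : representation G V) (rW : representation G W) :=
  exists f : {linear V -> W},
    injective f /\ {in G, forall g, forall v, f (rV g v) = rW g (f v)}.

Definition finite_dimensional (R : nzRingType) (V : lmodType R) : Prop :=
  exists (n : nat) (e : 'I_n -> V),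
    forall v, exists c : 'I_n -> R, v = \sum_(i < n) c i *: e i.

Definition countable_basis (R : nzRingType) (V : lmodType R) (e : nat -> V) :
    Prop :=
  (forall (n : nat) (c : 'I_n -> R),
     \sum_(i < n) c i *: e i = 0 -> forall i, c i = 0) /\
  (forall v, exists (n : nat) (c : 'I_n -> R), v = \sum_(i < n) c i *: e i).

Section Restriction.
Variables (R : nzRingType) (gT : finGroupType) (G H : {set gT}).
Variables (V : lmodType R) (sHG : H \subset G) (rho : representation G V).

Lemma res_linear : {in H, forall g, linear (rho g)}.
Proof. by move=> g /(subsetP sHG); apply: repr_linear. Qed.

Lemma res_funM : {in H &, forall g h, forall v,
  rho (g * h)%g v = rho g (rho h v)}.
Proof. by move=> g h /(subsetP sHG) gG /(subsetP sHG) hG; apply: repr_funM. Qed.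

Definition res_repr : representation H V :=
  Representation res_linear (repr_fun1 rho) res_funM.

End Restriction.

Section DirectPower.
Variables (R : nzRingType) (gT : finGroupType) (G : {set gT}).
Variables (V : lmodType R) (rho : representation G V) (n : nat).

Definition dpow_fun (g : gT) (f : {ffun 'I_n -> V}) : {ffun 'I_n -> V} :=
  [ffun i => rho g (f i)].

Lemma dpow_linear : {in G, forall g, linear (dpow_fun g)}.
Proof.
by move=> g gG a u v; apply/ffunP=> i; rewrite !ffunE (repr_linear rho gG).
Qed.

Lemma dpow_fun1 f : dpow_fun 1%g f = f.
Proof. by apply/ffunP=> i; rewrite ffunE repr_fun1. Qed.

Lemma dpow_funM : {in G &, forall g h, forall f,
  dpow_fun (g * h)%g f = dpow_fun g (dpow_fun h f)}.
Proof. by move=> g h gG hG f; apply/ffunP=> i; rewrite !ffunE repr_funM. Qed.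

Definition dpow_repr : representation G {ffun 'I_n -> V} :=
  Representation dpow_linear dpow_fun1 dpow_funM.

End DirectPower.

Section Subrepresentation.
Variables (R : nzRingType) (gT : finGroupType) (G : {group gT}).
Variables (V : lmodType R) (rho : representation G V).

Record subrep := Subrep {
  subrep_pred : {pred V};
  subrep_closed : submod_closed subrep_pred;
  subrep_stable : {in G & subrep_pred, forall g v, rho g v \in subrep_pred}
}.

Variable S : subrep.

HB.instance Definition _ :=
  GRing.isSubmodClosed.Build R V (subrep_pred S) (subrep_closed S).

Record subrep_type := SubrepType {
  subrep_val : V;
  _ : subrep_val \in subrep_pred S
}.

HB.instance Definition _ := [isSub for subrep_val].
HB.instance Definition _ := [Choice of subrep_type by <:].
HB.instance Definition _ := [SubChoice_isSubLmodule of subrep_type by <:].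

(* For [g] in [G] the default value of [insubd] is never used, by
   [subrep_stable]. *)
Definition sub_fun (g : gT) (v : subrep_type) : subrep_type :=
  insubd v (rho g (val v)).

Lemma sub_funE g v : g \in G -> val (sub_fun g v) = rho g (val v).
Proof. by move=> gG; rewrite insubdK //; apply: subrep_stable (valP v). Qed.

Lemma sub_linear : {in G, forall g, linear (sub_fun g)}.
Proof.
move=> g gG a u v; apply: val_inj.
by rewrite linearP /= !sub_funE // linearP /= (repr_linear rho gG).
Qed.

Lemma sub_fun1 v : sub_fun 1%g v = v.
Proof. by apply: val_inj; rewrite sub_funE ?group1 // repr_fun1. Qed.

Lemma sub_funM : {in G &, forall g h, forall v,
  sub_fun (g * h)%g v = sub_fun g (sub_fun h v)}.
Proof.
move=> g h gG hG v; apply: val_inj.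
by rewrite !sub_funE ?groupM // (repr_funM rho gG hG).
Qed.

Definition sub_repr : representation G subrep_type :=
  Representation sub_linear sub_fun1 sub_funM.

End Subrepresentation.

(* The representation of [H] induced from the representation [rho] of a
   subgroup [K], realised as the functions f : H -> V such that
   f (x k) = k^-1 f (x) for k in K, with (h f) (x) = f (h^-1 x).  The element
   of R[H] (x)_{R[K]} V corresponding to f is the sum of the x (x) f (x) over
   representatives x of the cosets x K, so that the functions supported on
   x K form the summand x (x) V of the induced representation. *)
Section Induction.
Variables (R : nzRingType) (gT : finGroupType) (H K : {group gT}).
Variables (V : lmodType R) (rho : representation K V).

Definition ind_pred : {pred {ffun subg_of H -> V}} :=
  [pred f : {ffun subg_of H -> V} |
    [forall x : subg_of H, forall k : subg_of H,
      (sgval k \in K) ==> (f (x * k)%g == rho (sgval k)^-1%g (f x))]].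

Lemma ind_predP (f : {ffun subg_of H -> V}) :
  reflect (forall x k : subg_of H, sgval k \in K ->
             f (x * k)%g = rho (sgval k)^-1%g (f x))
          (f \in ind_pred).
Proof.
apply: (iffP forallP) => [fP x k kK | fP x].
  by move/forallP: (fP x) => /(_ k) /implyP /(_ kK) /eqP.
by apply/forallP=> k; apply/implyP=> kK; apply/eqP/fP.
Qed.

Lemma ind_closed : submod_closed ind_pred.
Proof.
split=> [|a f g /ind_predP fP /ind_predP gP].
  apply/ind_predP=> x k kK; rewrite !ffunE.
  have lin := repr_linear rho (groupVr kK).
  by have := lin (-1) 0 0; rewrite scaler0 addr0 scaleN1r addNr => ->.
apply/ind_predP=> x k kK.
by rewrite !ffunE fP // gP // (repr_linear rho (groupVr kK)).
Qed.

HB.instance Definition _ :=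
  GRing.isSubmodClosed.Build R {ffun subg_of H -> V} ind_pred ind_closed.

Record ind_type := IndType {
  ind_val : {ffun subg_of H -> V};
  _ : ind_val \in ind_pred
}.

HB.instance Definition _ := [isSub for ind_val].
HB.instance Definition _ := [Choice of ind_type by <:].
HB.instance Definition _ := [SubChoice_isSubLmodule of ind_type by <:].

Lemma ind_fun_subproof (h : gT) (f : ind_type) :
  [ffun x => val f ((subg H h)^-1 * x)%g] \in ind_pred.
Proof.
apply/ind_predP=> x k kK; rewrite !ffunE mulgA.
by have /ind_predP -> := valP f.
Qed.

(* [subg H h] is [h] itself, as an element of the type of elements of [H],
   when [h] belongs to [H]. *)
Definition ind_fun (h : gT) (f : ind_type) : ind_type :=
  IndType (ind_fun_subproof h f).

Lemma ind_linear : {in H, forall h, linear (ind_fun h)}.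
Proof.
move=> h _ a f g; apply: val_inj; rewrite linearP /=.
by apply/ffunP=> x; rewrite !ffunE.
Qed.

Lemma ind_fun1 f : ind_fun 1%g f = f.
Proof.
apply: val_inj; apply/ffunP=> x; rewrite ffunE.
by rewrite (_ : subg H 1 = 1)%g ?invg1 ?mul1g //; apply: val_inj; rewrite /= subgK.
Qed.

Lemma ind_funM : {in H &, forall g h, forall f,
  ind_fun (g * h)%g f = ind_fun g (ind_fun h f)}.
Proof.
move=> g h gH hH f; apply: val_inj; apply/ffunP=> x; rewrite !ffunE.
by rewrite subgM // invMg mulgA.
Qed.

Definition ind_repr : representation H ind_type :=
  Representation ind_linear ind_fun1 ind_funM.

End Induction.

(* [{dot U for idfun}] is the type of positive definite symmetric bilinear
   forms on [U]. *)
Record universe (R : realType) (gT : finGroupType) (G : {group gT}) := Universe {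
  univ_space :> lmodType R;
  univ_repr : representation G univ_space;
  univ_dot : {dot univ_space for idfun};
  univ_orthogonal : {in G, forall g, forall u v,
    univ_dot (univ_repr g u) (univ_repr g v) = univ_dot u v};
  univ_countable : exists e : nat -> univ_space, countable_basis e;
  univ_trivial : exists S : subrep univ_repr,
    (exists2 v, v \in subrep_pred S & v != 0) /\
    {in G & subrep_pred S, forall g v, univ_repr g v = v};
  univ_power : forall (S : subrep univ_repr) (n : nat),
    finite_dimensional (subrep_type S) ->
    embeds (dpow_repr (sub_repr S) n) univ_repr
}.

Definition isometries_transfer (R : realType) (gT : finGroupType)
    (G : {group gT}) (U : universe R G) (K H : {group gT}) : Prop :=
  exists (sKH : K \subset H) (sHG : H \subset G),
    embeds (ind_repr H (res_repr (subset_trans sKH sHG) (univ_repr U)))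
           (res_repr sHG (univ_repr U)).

Definition saturated_group (R : realType) (gT : finGroupType)
    (G : {group gT}) : Prop :=
  forall T : {group gT} -> {group gT} -> Prop,
    transfer_system G T -> saturated_transfer G T ->
    exists U : universe R G,
      forall K H : {group gT}, K \subset G -> H \subset G ->
        (T K H <-> isometries_transfer U K H).

(* Main.v *)
From HB Require Import structures.
Require Import Defs.
From mathcomp Require Import all_boot all_order all_algebra all_fingroup.
From mathcomp Require Import reals.
From mathcomp Require Import boolp zify lra cyclic commutator pgroup.

(* A Hamiltonian group contains x, y generating a quaternion group Q_8
   (Dedekind: take a non-commuting pair minimising #[x] + #[y]). Let Z =
   <x^2>. As all subgroups are normal and Z is the maximal subgroup of <x>,
   the relation whose only non-trivial transfer is Z -> <x> is a saturated
   transfer system. If a universe U realised it, the transfer Z -> <x> would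
   produce w <> 0 in U with x w = - w. As x y = y x x^2 and x^2 fixes w, also
   x y w = - y w, so either y w = - w, or u = w + y w is a non-zero vector
   with y u = u and x u = - u, whence x y u = - u. So U contains the sign
   representation of <h> over Z for h = y or h = x y, where h^2 = x^2 and <h>
   <> <x>. But then Z -> <h> also holds in U: the irreducible representations
   of <h> occurring in U are then all of them, or all those on which Z acts
   trivially if Z acts trivially on U. *)

Set Implicit Arguments.
Unset Strict Implicit.
Unset Printing Implicit Defensive.

Import Order.TTheory GRing.Theory Num.Theory.

(** * Quaternion relations in a Hamiltonian group *)

Section Dedekind.
Local Open Scope group_scope.

Section MinimalPair.
Variables (gT : finGroupType) (G : {group gT}).
Hypothesis commg_cycle :
  {in G &, forall a b : gT, [~ a, b] \in <[a]>}.

Lemma commg_cycler : {in G &, forall a b : gT, [~ a, b] \in <[b]>}.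
Proof.
by move=> a b aG bG; rewrite -invg_comm groupV commg_cycle.
Qed.

Lemma commute_cycle (a b : gT) : b \in <[a]> -> commute b a.
Proof. by case/cycleP=> i ->; exact/commute_sym/commuteX. Qed.

(** For a prime q dividing the order of [x], minimality makes [x ^+ q] commute with [y]; as [c] is
    central in the group generated by [x] and [y], c^q = 1. The same holds for [y], so [c] has prime
    order [p] and both orders are powers of [p]. Replacing [y] by [w^-1 * y], for a suitable power
    [w] of [x], must not lower its order, and this forces p = 2 and both orders equal to 4. *)
Lemma minimal_pair_quaternion (x y : gT) :
    x \in G -> y \in G -> [~ x, y] != 1 -> #[y] <= #[x] ->
    {in G &, forall a b, [~ a, b] != 1 -> #[x] + #[y] <= #[a] + #[b]} ->
  [/\ #[x] = 4, y ^+ 2 = x ^+ 2 & [~ x, y] = x ^+ 2].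
Proof.
move=> xG yG; set c := [~ x, y] => c1 le_yx minxy.
have cx : c \in <[x]> by exact: commg_cycle.
have cy : c \in <[y]> by exact: commg_cycler.
have comx : commute x c by exact/commute_sym/commute_cycle.
have comy : commute y c by exact/commute_sym/commute_cycle.
have x_gt1 : 1 < #[x].
  by rewrite order_gt1; apply: contra c1 => /eqP x1; rewrite /c x1 comm1g.
have y_gt1 : 1 < #[y].
  by rewrite order_gt1; apply: contra c1 => /eqP y1; rewrite /c y1 commg1.
have primex q : prime q -> q %| #[x] -> [~ x ^+ q, y] = 1.
  move=> q_pr qx; apply/eqP; apply: contraT => /minxy.
  rewrite groupX // leq_add2r orderXdiv // => /(_ isT yG).
  by rewrite leqNgt ltn_Pdiv ?prime_gt1 // ltnW.
have primey q : prime q -> q %| #[y] -> [~ x, y ^+ q] = 1.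
  move=> q_pr qy; apply/eqP; apply: contraT => /minxy.
  rewrite groupX // leq_add2l orderXdiv // => /(_ xG isT).
  by rewrite leqNgt ltn_Pdiv ?prime_gt1 // ltnW.
have ordx q : prime q -> q %| #[x] -> #[c] = q.
  by move=> q_pr qx; apply: nt_prime_order; rewrite // -commXg // primex.
have ordy q : prime q -> q %| #[y] -> #[c] = q.
  by move=> q_pr qy; apply: nt_prime_order; rewrite // -commgX // primey.
set p := pdiv #[x]; have p_pr : prime p by exact: pdiv_prime.
have oc : #[c] = p by apply: ordx => //; exact: pdiv_dvd.
have [a xa] : {a | #[x] = (p ^ a)%N}.
  apply: p_natP; apply/(pnatP _ (order_gt0 _)) => q q_pr q_dv.
  by rewrite -(ordx q q_pr q_dv) oc inE.
have [b yb] : {b | #[y] = (p ^ b)%N}.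
  apply: p_natP; apply/(pnatP _ (order_gt0 _)) => q q_pr q_dv.
  by rewrite -(ordy q q_pr q_dv) oc inE.
have le_ba : b <= a by rewrite -(leq_exp2l _ _ (prime_gt1 p_pr)) -xa -yb.
have b_gt1 : 1 < b.
  case: b yb {le_ba} => [|[|b]] // yb; first by rewrite yb in y_gt1.
  have eyc : <[c]> = <[y]>.
    by apply/eqP; rewrite eqEcard cycle_subG cy /= -!orderE oc yb expn1.
  have : commute y x.
    apply: commute_sym; have: y \in <[c]> by rewrite eyc cycle_id.
    by case/cycleP=> i ->; apply: commuteX.
  by move/commute_sym/commgP; rewrite -/c (negPf c1).
have socle z k : #[z] = (p ^ k.+1)%N -> c \in <[z]> -> <[z ^+ (p ^ k)]> = <[c]>.
  move=> oz cz; apply/eqP.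
  by rewrite (eq_subG_cyclic (cycle_cyclic z)) ?cycle_subG ?mem_cycle //
    -!orderE oc (orderXexp _ oz) subSnn expn1.
(* The unique subgroup of order [p] is [<[c]>] both in [<[x]>] and in [<[y]>], and [y ^+ n]
   generates it; hence [y ^+ n] has an n-th root [w] in [<[x]>]. *)
set n := (p ^ b.-1)%N.
have [t Dt] : exists t, y ^+ n = x ^+ (p ^ a.-1 * t).
  have: y ^+ n \in <[x ^+ (p ^ a.-1)]>.
    rewrite socle ?(prednK (leq_trans _ le_ba)) ?(ltnW b_gt1) //.
    by rewrite -(@socle y b.-1) ?cycle_id ?prednK // ltnW.
  by case/cycleP=> t ->; exists t; rewrite expgM.
set w := x ^+ (p ^ (a - b) * t).
have wn : w ^+ n = y ^+ n.
  rewrite Dt -expgM -mulnA (mulnC t) mulnA -expnD; congr (x ^+ (p ^ _ * t)).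
  by rewrite -(subnK le_ba) addnK; case: (b) b_gt1 => // b' _; rewrite addnS.
have xw : commute x w^-1 by exact/commuteV/commuteX.
have y'_min : #[y] <= #[w^-1 * y].
  rewrite -(leq_add2l #[x]) minxy ?groupM ?groupV ?groupX //.
  apply: contra c1 => /commgP xy'; apply/commgP; rewrite -(mulKVg w y).
  by apply: commuteM => //; apply/commuteX.
set d := [~ y, w^-1].
have [k Dk] : exists k, w^-1 = x ^+ k.
  by apply/cycleP; rewrite groupV mem_cycle.
have Dd : d = c^-1 ^+ k.
  rewrite /d Dk commgX -(invg_comm x y) //.
  exact: commuteV.
have comyd : commute y d by rewrite Dd; exact/commuteX/commuteV.
have comxd : commute x d by rewrite Dd; exact/commuteX/commuteV.
(* Since [d] commutes with both factors, (w^-1 y)^n = w^-n y^n d^C(n,2). If the last factor were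
   trivial, [w^-1 * y] would have order at most n < #[y]. *)
have dC : d ^+ 'C(n, 2) != 1.
  apply: contraL y'_min => /eqP dC.
  have: (w^-1 * y) ^+ n = 1.
    rewrite expMg_Rmul // ?expgVn ?wn ?dC ?mulg1 ?mulVg //.
    rewrite -/d Dk; apply: commute_sym; apply: commuteX; exact: commute_sym.
  move/eqP; rewrite -order_dvdn -ltnNge => /dvdn_leq y'n.
  apply: leq_ltn_trans (y'n _) _; rewrite ?expn_gt0 ?prime_gt0 //.
  by rewrite yb ltn_exp2l ?prime_gt1 // prednK // ltnW.
have dp : d ^+ p = 1.
  by rewrite Dd -expgM mulnC expgM expgVn -oc expg_order invg1 expg1n.
have pC : ~~ (p %| 'C(n, 2)).
  by apply: contra dC => /dvdnP[i ->]; rewrite mulnC expgM dp expg1n.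
have p_dv_n : p %| n by rewrite dvdn_exp // -ltnS prednK // ltnW.
have p2 : p = 2%N.
  case: (even_prime p_pr) => // p_odd; case/negP: pC.
  rewrite -(@Gauss_dvdr _ 2) ?coprimen2 // -mul_bin_diag.
  exact: dvdn_mulr.
(* For b > 2, 4 divides [n], so C(n,2) is even. *)
have b2 : b = 2%N.
  apply/eqP; rewrite eqn_leq b_gt1 andbT leqNgt; apply: contra pC => b_gt2.
  have Dn : n = (2 * (2 * 2 ^ (b - 3)))%N.
    rewrite /n p2 -!expnS; case: (b) b_gt2 => [|[|[|b']]] //.
    by rewrite !subSS subn0.
  by rewrite p2 bin2 {1}Dn -mulnA mul2n doubleK -mulnA dvdn_mulr.
(* For a > 2, [w] is a power of [x ^+ 2], which commutes with [y], so d = 1. *)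
have a2 : a = 2%N.
  apply/eqP; rewrite eqn_leq -{2}b2 le_ba andbT leqNgt.
  apply: contra dC => a_gt2; suff -> : d = 1 by rewrite expg1n.
  apply/eqP/commgP; apply: commuteV; apply: commute_sym.
  rewrite /w b2 -(@prednK (a - 2)) ?subn_gt0 // expnS -mulnA expgM.
  apply: commute_sym; apply: commuteX; apply: commute_sym.
  by apply/commgP/eqP/primex; rewrite // xa dvdn_exp // ltnW // ltnW.
have invol z : #[z] = (2 ^ 2)%N -> c \in <[z]> -> c = z ^+ 2.
  move=> oz cz; have : c \in <[z ^+ 2]>.
    by rewrite -[2%N]/(2 ^ 1)%N -{1}p2 (socle _ 1%N) ?cycle_id // p2.
  by rewrite cycle2g ?(orderXexp 1 oz) // !inE (negPf c1) => /eqP.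
have <- : c = x ^+ 2 by apply: invol; rewrite // xa p2 a2.
by rewrite xa p2 a2; split=> //; rewrite -invol // yb p2 b2.
Qed.

End MinimalPair.

Lemma hamiltonian_quaternion (gT : finGroupType) (G : {group gT}) :
    hamiltonian G ->
  exists x y : gT, [/\ x \in G, y \in G, #[x] = 4, y ^+ 2 = x ^+ 2
    & [~ x, y] = x ^+ 2].
Proof.
case=> nabG nG.
have commG : {in G &, forall a b : gT, [~ a, b] \in <[a]>}.
  move=> a b aG bG; rewrite /commg groupM ?groupV ?cycle_id //.
  have /andP[_ /subsetP nH] : <[a]> <| G by apply: nG; rewrite cycle_subG.
  by rewrite memJ_norm ?nH ?cycle_id.
pose P (z : gT * gT) := [&& z.1 \in G, z.2 \in G & [~ z.1, z.2] != 1].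
have [z0 Pz0] : exists z, P z.
  case/subsetPn: nabG => a aG nCa.
  have: ~~ [forall b in G, [~ a, b] == 1].
    by apply: contra nCa => /forall_inP ab; apply/centP=> b /ab /commgP.
  by case/forall_inPn=> b bG ab; exists (a, b); apply/and3P.
case: (arg_minnP (fun z : gT * gT => #[z.1] + #[z.2]) Pz0) => -[x y].
case/and3P => /= xG yG xy1 min.
have minxy : {in G &, forall a b, [~ a, b] != 1 -> #[x] + #[y] <= #[a] + #[b]}.
  by move=> a b aG bG ab; apply: (min (a, b)); rewrite /P /= aG bG.
have [le_yx | /ltnW le_xy] := leqP #[y] #[x].
  have [] := minimal_pair_quaternion commG xG yG xy1 le_yx minxy.
  by exists x, y.
exists y, x; rewrite yG xG.
have [||-> -> ->] := minimal_pair_quaternion commG yG xG _ le_xy => //.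
  by rewrite -invg_comm invg_eq1.
by move=> a b aG bG ab; rewrite addnC; apply: minxy.
Qed.

End Dedekind.

Local Open Scope ring_scope.

(** * Infinite families of vectors with independent orbits *)

Lemma steinitz (R : fieldType) (V : lmodType R) (J : finType) (e : J -> V)
    (n : nat) (v : 'I_n -> V) :
    (#|J| < n)%N ->
    (forall j, exists c : J -> R, v j = \sum_k c k *: e k) ->
  exists2 d : 'I_n -> R, \sum_j d j *: v j = 0 & exists j, d j != 0.
Proof.
move=> ltJn /fin_all_exists[c vE].
pose C := \matrix_(j < n, k < #|J|) c j (enum_val k).
have /rowV0Pn[u /sub_kermxP uC u0] : kermx C != 0.
  rewrite -mxrank_eq0 mxrank_ker -lt0n subn_gt0.
  by rewrite (leq_ltn_trans (rank_leq_col C)).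
exists (u 0); last first.
  apply/existsP; apply: contraR u0; rewrite negb_exists => /forallP u0.
  by apply/eqP/rowP=> j; have := u0 j; rewrite negbK mxE => /eqP.
under eq_bigr => j _ do rewrite vE scaler_sumr.
rewrite exchange_big big1 // => k _.
under eq_bigr => j _ do rewrite scalerA.
rewrite -scaler_suml; have /rowP/(_ (enum_rank k)) := uC.
rewrite !mxE; under eq_bigr => j _ do rewrite mxE enum_rankK.
by move->; rewrite scale0r.
Qed.

Section FreeOrbits.
Variables (R : fieldType) (V : lmodType R) (m : nat) (A : 'I_m -> V -> V).

(** For [A i] the action of h^i, with h^m acting trivially, this says that the [w j] are a basis of
    a free module over the group ring of Z/m. *)
Definition free_orbits n (w : 'I_n -> V) :=
  forall c : 'I_n -> 'I_m -> R,
    \sum_j \sum_i c j i *: A i (w j) = 0 -> forall j i, c j i = 0.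

Definition orbit_span n (w : 'I_n -> V) v :=
  exists c : 'I_n -> 'I_m -> R, v = \sum_j \sum_i c j i *: A i (w j).

Hypothesis many_orbits : forall n, exists w : 'I_n -> V, free_orbits w.

(** Dimension count: take nm + 1 vectors with free orbits. If each had a non-trivial combination of
    its orbit inside the span of the nm vectors A_i w_j, these combinations would be dependent,
    against freeness. *)
Lemma fresh_orbit n (w : 'I_n -> V) : exists v, forall c : 'I_m -> R,
  orbit_span w (\sum_i c i *: A i v) -> forall i, c i = 0.
Proof.
have [v freev] := many_orbits (n * m).+1.
apply: contrapT => /forallNP nfresh.
have /fin_all_exists2[c cw c0] j : exists2 c : 'I_m -> R,
    orbit_span w (\sum_i c i *: A i (v j)) & exists i, c i != 0.
  have /existsNP[c /not_implyP[cw /existsNP[i /eqP ci]]] := nfresh (v j).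
  by exists c => //; exists i.
have [||d dv [j dj]] := @steinitz R V ('I_n * 'I_m)%type
    (fun k => A k.2 (w k.1)) (n * m).+1 (fun j => \sum_i c j i *: A i (v j)).
- by rewrite card_prod !card_ord.
- move=> j; have [b ->] := cw j; exists (fun k => b k.1 k.2).
  by rewrite pair_bigA.
have [i] := c0 j; suff: d j * c j i = 0.
  by move/eqP; rewrite mulf_eq0 (negPf dj) => /= /eqP->; rewrite eqxx.
apply: (freev (fun j i => d j * c j i)); rewrite -[RHS]dv.
apply: eq_bigr => k _.
by rewrite scaler_sumr; apply: eq_bigr => l _; rewrite scalerA.
Qed.

(** The free families of the various sizes need not be nested, so the sequence is built greedily,
    each term being fresh for the list [pre n] of its predecessors. *)
Lemma free_orbit_sequence :
  exists w : nat -> V, forall n, free_orbits (fun j : 'I_n => w j).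
Proof.
have /choice[next nextP] (s : seq V) :=
  fresh_orbit (fun j : 'I_(size s) => s`_j).
pose pre := fix pre n :=
  if n is n'.+1 then rcons (pre n') (next (pre n')) else [::].
pose w n := next (pre n).
have preE n : pre n = mkseq w n.
  by elim: n => //= n IHn; rewrite mkseqS -{1}IHn.
exists w; elim=> [|n IHn] c; first by move=> _ [].
rewrite big_ord_recr /= => c0.
have cn i : c ord_max i = 0.
  apply: (nextP (pre n)); rewrite preE size_mkseq.
  exists (fun j i => - c (widen_ord (leqnSn n) j) i).
  move/eqP: c0; rewrite addrC addr_eq0 -preE => /eqP ->; rewrite -sumrN.
  apply: eq_bigr => j _; rewrite -sumrN; apply: eq_bigr => k _.
  by rewrite scaleNr preE nth_mkseq.
move: c0; rewrite [X in _ + X]big1 => [|i _]; last by rewrite cn scale0r.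
rewrite addr0 => /IHn c0 j i.
have [->|jn] := eqVneq j ord_max; first exact: cn.
have ltjn : (j < n)%N by rewrite ltn_neqAle -ltnS ltn_ord andbT.
by rewrite -(c0 (Ordinal ltjn) i); congr c; apply: val_inj.
Qed.

End FreeOrbits.

(** The bound [d v] on the support lets the coordinates of several vectors be compared in sums of
    one common length. *)
Lemma countable_basis_coord (R : nzRingType) (V : lmodType R) (e : nat -> V) :
    countable_basis e ->
  exists (c : V -> nat -> R) (d : V -> nat),
    [/\ forall v n, (d v <= n)%N -> v = \sum_(i < n) c v i *: e i,
        forall v i, (d v <= i)%N -> c v i = 0
      & forall a u v i, c (a *: u + v) i = a * c u i + c v i].
Proof.
case=> free_e span_e.
have /choice[f fP] v : exists p : nat * (nat -> R),
    (forall n, (p.1 <= n)%N -> v = \sum_(i < n) p.2 i *: e i) /\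
    (forall i, (p.1 <= i)%N -> p.2 i = 0).
  have [n [c vE]] := span_e v.
  pose b i := if insub i is Some j then c j else 0.
  have b0 i : (n <= i)%N -> b i = 0 by move=> ni; rewrite /b insubN // -leqNgt.
  exists (n, b); split=> //= N leN; rewrite vE.
  rewrite [RHS](bigID (fun i : 'I_N => (i < n)%N)) /= addrC.
  rewrite [X in _ = X + _]big1 => [|i]; last first.
    by rewrite -leqNgt => /b0 ->; rewrite scale0r.
  rewrite add0r [RHS](big_ord_narrow leN); apply: eq_bigr => i _.
  by rewrite /b /= valK.
exists (fun v => (f v).2), (fun v => (f v).1); split.
- by move=> v n; case: (fP v) => + _; apply.
- by move=> v i; case: (fP v) => _; apply.
move=> a u v i.
pose N := maxn i.+1 (maxn (f (a *: u + v)).1 (maxn (f u).1 (f v).1)).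
have lts : ((f (a *: u + v)%R).1 <= N)%N by rewrite /N; lia.
have ltu : ((f u).1 <= N)%N by rewrite /N; lia.
have ltv : ((f v).1 <= N)%N by rewrite /N; lia.
have lti : (i < N)%N by rewrite /N; lia.
have := free_e N (fun k => (f (a *: u + v)).2 k - (a * (f u).2 k + (f v).2 k)).
move=> /(_ _ (Ordinal lti)) /= free_i; apply/eqP; rewrite -subr_eq0; apply/eqP.
apply: free_i; under eq_bigr => k _ do rewrite scalerBl scalerDl -scalerA.
rewrite sumrB big_split /= -scaler_sumr.
rewrite -(fP (a *: u + v)).1 // -(fP u).1 // -(fP v).1 //.
exact: subrr.
Qed.

(** [psi] sends the basis [e] to a sequence [w] with free orbits, so a relation between the A_i
    psi(v_i) is one between the A_i w_j, with the coordinates of the v_i as coefficients. *)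
Lemma free_orbit_map (R : fieldType) (V W : lmodType R) (e : nat -> V) (m : nat)
    (A : 'I_m -> W -> W) :
    countable_basis e -> (forall i, linear (A i)) ->
    (forall n, exists w : 'I_n -> W, free_orbits A w) ->
  exists2 psi : V -> W, linear psi &
    forall v : 'I_m -> V, \sum_i A i (psi (v i)) = 0 -> forall i, v i = 0.
Proof.
move=> /countable_basis_coord[c [d [cE c0 cD]]] linA.
move=> /free_orbit_sequence[w freew].
pose psi v := \sum_(i < d v) c v i *: w i.
have psiE v n : (d v <= n)%N -> psi v = \sum_(i < n) c v i *: w i.
  move=> len; rewrite [RHS](bigID (fun i : 'I_n => (i < d v)%N)) /= addrC.
  rewrite [X in _ = X + _]big1; first by rewrite add0r (big_ord_narrow len).
  by move=> i; rewrite -leqNgt => /c0 ->; rewrite scale0r.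
exists psi => [a u v | v v0 i].
  pose N := maxn (d (a *: u + v)) (maxn (d u) (d v)).
  rewrite (@psiE _ N) ?(@psiE u N) ?(@psiE v N); try by rewrite /N; lia.
  rewrite scaler_sumr -big_split /=; apply: eq_bigr => k _.
  by rewrite cD scalerDl scalerA.
pose N := (\max_i d (v i))%N.
have leN k : (d (v k) <= N)%N by exact: leq_bigmax.
rewrite (cE _ _ (leN i)) big1 // => k _.
rewrite (freew N (fun j i => c (v i) j)) ?scale0r //.
rewrite exchange_big -[RHS]v0; apply: eq_bigr => l _.
rewrite (psiE _ _ (leN l)).
pose L := GRing.isLinear.Build R W W *:%R (A l) (linA l).
pose g : {linear W -> W} := HB.pack (A l) L.
rewrite -[A l]/(g : W -> W) linear_sum.
by apply: eq_bigr => j _; rewrite linearZ.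
Qed.

(** * The subrepresentation generated by one vector *)

Section RepresentationTheory.
Variables (R : nzRingType) (gT : finGroupType) (G : {group gT}).
Variables (V : lmodType R) (rho : representation G V).

Lemma repr_linear_morph (g : gT) :
  g \in G -> exists f : {linear V -> V}, rho g = f.
Proof.
move=> gG; pose L := GRing.isLinear.Build R V V *:%R _ (repr_linear rho gG).
pose f : {linear V -> V} := HB.pack (rho g) L.
by exists f.
Qed.

Lemma repr0 (g : gT) : g \in G -> rho g 0 = 0.
Proof. by case/repr_linear_morph=> f ->; rewrite linear0. Qed.

Lemma reprN (g : gT) (v : V) : g \in G -> rho g (- v) = - rho g v.
Proof. by case/repr_linear_morph=> f ->; rewrite linearN. Qed.

Lemma reprD (g : gT) (u v : V) : g \in G -> rho g (u + v) = rho g u + rho g v.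
Proof. by case/repr_linear_morph=> f ->; rewrite linearD. Qed.

Lemma reprZ (g : gT) (a : R) (v : V) : g \in G -> rho g (a *: v) = a *: rho g v.
Proof. by case/repr_linear_morph=> f ->; rewrite linearZ. Qed.

Lemma repr_sum (g : gT) (I : Type) (r : seq I) (P : pred I) (F : I -> V) :
  g \in G -> rho g (\sum_(i <- r | P i) F i) = \sum_(i <- r | P i) rho g (F i).
Proof. by case/repr_linear_morph=> f ->; rewrite linear_sum. Qed.

Variable w : V.

Definition orbit_pred : {pred V} :=
  [pred v | `[< exists c : gT -> R, v = \sum_(g in G) c g *: rho g w >]].

Lemma orbit_predP (v : V) :
  reflect (exists c : gT -> R, v = \sum_(g in G) c g *: rho g w)
    (v \in orbit_pred).
Proof. exact: asboolP. Qed.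

Lemma orbit_closed : submod_closed orbit_pred.
Proof.
split=> [|a u v /orbit_predP[c ->] /orbit_predP[d ->]]; apply/orbit_predP.
  by exists (fun=> 0); rewrite big1 // => g _; rewrite scale0r.
exists (fun g => a * c g + d g); rewrite scaler_sumr -big_split.
by apply: eq_bigr => g _; rewrite scalerDl scalerA.
Qed.

Lemma orbit_stable :
  {in G & orbit_pred, forall g v, rho g v \in orbit_pred}.
Proof.
move=> g v gG /orbit_predP[c ->]; apply/orbit_predP.
exists (fun h => c (g^-1 * h)%g); rewrite repr_sum //.
rewrite [RHS](reindex_inj (mulgI g)) /=; apply: eq_big => h.
  by rewrite groupMl.
by move=> hG; rewrite mulKg reprZ // repr_funM.
Qed.

(** Being finite-dimensional, it is a legitimate input for [univ_power]. *)
Definition orbit_subrep : subrep rho := Subrep orbit_closed orbit_stable.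

Lemma orbit_subrep_finite : finite_dimensional (subrep_type orbit_subrep).
Proof.
have orb g : g \in G -> rho g w \in orbit_pred.
  move=> gG; apply/orbit_predP; exists (fun h => (h == g)%:R).
  rewrite (bigD1 g) //= eqxx scale1r big1 ?addr0 // => h /andP[_ /negPf->].
  by rewrite scale0r.
exists #|G|, (fun k => @SubrepType _ _ _ _ _ orbit_subrep _
    (orb _ (enum_valP k))) => v.
have /orbit_predP[c vE] := valP v.
exists (fun k => c (enum_val k)); apply: val_inj; rewrite vE big_enum_val.
by rewrite linear_sum; apply: eq_bigr => k _; rewrite linearZ.
Qed.

Lemma mem_orbit_subrep : w \in subrep_pred orbit_subrep.
Proof.
apply/orbit_predP; exists (fun h => (h == 1%g)%:R).
rewrite (bigD1 1%g) //= eqxx scale1r repr_fun1 big1 ?addr0 // => h.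
by move=> /andP[_ /negPf->]; rewrite scale0r.
Qed.

End RepresentationTheory.

(** * Embedding induced representations of cyclic groups *)

Section Universe.
Variables (R : realType) (gT : finGroupType) (G : {group gT}).
Variable U : universe R G.
Local Notation rho := (univ_repr U).

(** The n-th power of the subrepresentation generated by [w] embeds in [U]; the images of the copies
    of [w] in the n factors have independent orbits. *)
Lemma universe_free_orbits (m : nat) (g : 'I_m -> gT) (w : U) :
    (forall i, g i \in G) ->
    (forall c : 'I_m -> R,
       \sum_i c i *: rho (g i) w = 0 -> forall i, c i = 0) ->
  forall n, exists v : 'I_n -> U, free_orbits (fun i => rho (g i)) v.
Proof.
move=> gG freew n.
have [f [inj_f fE]] := univ_power n (orbit_subrep_finite rho w).
pose w0 := SubrepType (mem_orbit_subrep rho w).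
pose d j := [ffun k : 'I_n => if k == j then w0 else 0].
exists (fun j => f (d j)) => c c0 j.
apply: freew => /=.
have fc0 : f (\sum_j \sum_i
    c j i *: dpow_repr (sub_repr (orbit_subrep rho w)) n (g i) (d j)) = f 0.
  rewrite linear0 -[RHS]c0 linear_sum; apply: eq_bigr => k _.
  by rewrite linear_sum; apply: eq_bigr => i _; rewrite linearZ /= fE.
move/inj_f/ffunP/(_ j): fc0.
rewrite sum_ffunE (bigD1 j) //= [X in _ + X]big1 => [|k kj]; last first.
  rewrite sum_ffunE big1 // => i _; rewrite !ffunE eq_sym (negPf kj).
  by rewrite repr0 // scaler0.
move/(congr1 val); rewrite addr0 sum_ffunE linear_sum ffunE /= => E.
rewrite -[RHS]E; apply: eq_bigr => i _; rewrite !ffunE eqxx.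
by rewrite -[RHS]/(val (_ *: _)) linearZ /= sub_funE.
Qed.

(** As h^m lies in [K] and acts trivially, the functions forming the induced representation are
    m-periodic along the powers of [h]. They thus embed in a countable sum of copies of R[Z/m], and
    such a sum embeds in [U] because [w] generates one copy. *)
Lemma cyclic_transfer (h : gT) (K : {group gT}) (m : nat) (w : U) :
    h \in G -> K \subset <[h]>%g -> (h ^+ m)%g \in K ->
    (forall v, rho (h ^+ m)%g v = v) ->
    (forall c : 'I_m -> R,
       \sum_i c i *: rho (h ^+ i)%g w = 0 -> forall i, c i = 0) ->
  (0 < m)%N -> isometries_transfer U K <[h]>%G.
Proof.
move=> hG sKH hmK hm1 freew m_gt0.
have sHG : <[h]>%G \subset G by rewrite cycle_subG.
exists sKH, sHG; have [e basis_e] := univ_countable U.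
have hXG i : (h ^+ i)%g \in G by rewrite groupX.
have [psi lin_psi inj_psi] := free_orbit_map basis_e
  (fun i : 'I_m => repr_linear rho (hXG i))
  (universe_free_orbits (fun i : 'I_m => hXG i) freew).
set I := ind_repr _ _.
pose s i := subg <[h]> (h ^+ i)%g.
have sE i : sgval (s i) = (h ^+ i)%g by rewrite subgK // mem_cycle.
have sM i j : (s i * s j)%g = s (i + j)%N.
  by apply: val_inj; rewrite /= !sE expgD.
have shift (phi : ind_type <[h]>%G (res_repr (subset_trans sKH sHG) rho)) x i :
    val phi (x * s (i * m)%N)%g = val phi x.
  elim: i => [|i IHi].
    rewrite (_ : s _ = 1%g) ?mulg1 //.
    by apply: val_inj; rewrite /= sE.
  rewrite mulSn addnC -sM mulgA.
  have /ind_predP -> := valP phi; last by rewrite sE.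
  by rewrite IHi /= sE -{1}[val phi x]hm1 -repr_funM ?groupV // mulVg repr_fun1.
(* For any linear psi, equivariant or not, this map commutes with h; it is
   injective because psi sends a basis to vectors with free orbits. *)
pose Phi (phi : ind_type <[h]>%G (res_repr (subset_trans sKH sHG) rho)) :=
  \sum_(i < m) rho (h ^+ i)%g (psi (val phi (s i))).
have lin_Phi : linear Phi.
  move=> a u v; rewrite /Phi scaler_sumr -big_split; apply: eq_bigr => i _ /=.
  by rewrite !ffunE lin_psi (repr_linear rho (hXG i)).
pose L := GRing.isLinear.Build R _ _ *:%R Phi lin_Phi.
pose F : {linear ind_type <[h]>%G (res_repr (subset_trans sKH sHG) rho) -> U} :=
  HB.pack Phi L.
exists F; split.
  apply: raddf_inj => phi phi0; apply: val_inj; apply/ffunP=> x.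
  have /cycleP[k xk] := subgP x.
  have -> : x = (s (k %% m)%N * s (k %/ m * m)%N)%g.
    by apply: val_inj; rewrite sM /= sE xk addnC -divn_eq.
  rewrite shift [RHS]ffunE.
  exact: (inj_psi (fun i => val phi (s i)) phi0 (Ordinal (ltn_pmod k m_gt0))).
(* Both sides are the same sum with the index shifted by one. The first term on the left matches the
   last on the right, since h^m acts trivially and phi(h^-1) = phi(h^(m-1)) by periodicity. *)
have step phi : F (I h phi) = rho h (F phi).
  rewrite /= /Phi; case: (m) m_gt0 hm1 hmK shift => // n _ hn1 _ shift.
  rewrite repr_sum // big_ord_recl [RHS]big_ord_recr addrC /=; congr (_ + _).
    apply: eq_bigr => i _; rewrite -repr_funM // -expgS; congr (rho _ (psi _)).
    rewrite ffunE -[s (bump _ _)]/(s (1 + i)%N) -sM.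
    by rewrite (_ : s 1%N = subg _ h) ?mulKg // /s expg1.
  rewrite -repr_funM // -expgS hn1 expg0 repr_fun1 ffunE; congr psi.
  rewrite -(shift _ _ 1%N); congr (val phi _); rewrite mul1n -mulgA sM.
  rewrite (_ : subg _ h = s 1%N); last by rewrite /s expg1.
  by rewrite add0n -(add1n n) -sM mulKg.
move=> g /cycleP[k ->] phi; elim: k => [|k IHk].
  by rewrite expg0 !repr_fun1.
rewrite expgS (repr_funM I) ?cycle_id ?mem_cycle // step IHk.
by rewrite /= repr_funM // -[h]expg1.
Qed.

End Universe.

Lemma addr_subr_eq0 (R : realType) (V : lmodType R) (a b : V) :
  a + b = 0 -> a - b = 0 -> a = 0 /\ b = 0.
Proof.
move=> ab0 /eqP; rewrite subr_eq0 => /eqP ab; rewrite {}ab in ab0 *.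
suff -> : b = 0 by [].
apply/eqP; have /eqP := ab0; rewrite -mulr2n -scaler_nat scaler_eq0.
by rewrite pnatr_eq0.
Qed.

(** * Transfers and the sign representation *)

Section SignTransfer.
Variables (R : realType) (gT : finGroupType) (G : {group gT}).
Variable U : universe R G.
Local Notation rho := (univ_repr U).

Lemma universe_fixed :
  exists2 v : U, v != 0 & {in G, forall g, rho g v = v}.
Proof.
have [S [[v vS v0] fixS]] := univ_trivial U.
by exists v => // g gG; apply: fixS.
Qed.

(** By [cyclic_transfer] it suffices to find a vector with free orbit, namely a sum of vectors from
    distinct irreducibles: [v + u] (trivial and sign) for m = 2 if h^2 acts trivially, and otherwise
    [v + u + s] for m = 4, where [s] lies in the plane on which [h] acts as a quarter turn. *)
Lemma sign_transfer (h : gT) (u : U) :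
    h \in G -> (h ^+ 4)%g = 1%g -> u != 0 -> rho h u = - u ->
  isometries_transfer U <[(h ^+ 2)%g]>%G <[h]>%G.
Proof.
move=> hG h4 u0 hu; have [v v0 fixv] := universe_fixed.
have hXG i : (h ^+ i)%g \in G by rewrite groupX.
have hXv i : rho (h ^+ i)%g v = v by exact: fixv.
have hXu i : rho (h ^+ i)%g u = (-1) ^+ i *: u.
  elim: i => [|i IHi]; first by rewrite expg0 repr_fun1 expr0 scale1r.
  by rewrite expgS repr_funM // IHi reprZ // hu exprS mulN1r scalerN scaleNr.
pose P m (c : 'I_m -> R) x := \sum_i c i *: rho (h ^+ i)%g x.
have PD m (c : 'I_m -> R) x y : P m c (x + y) = P m c x + P m c y.
  rewrite -big_split; apply: eq_bigr => i _.
  by rewrite reprD // scalerDr.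
have PM m (c : 'I_m -> R) x j :
    P m c (rho (h ^+ j)%g x) = rho (h ^+ j)%g (P m c x).
  rewrite repr_sum //; apply: eq_bigr => i _.
  by rewrite reprZ // -!repr_funM // -!expgD addnC.
have PZ m (c : 'I_m -> R) a x : P m c (a *: x) = a *: P m c x.
  rewrite scaler_sumr; apply: eq_bigr => i _.
  by rewrite reprZ // !scalerA mulrC.
have Puv m (c : 'I_m -> R) : P m c v + P m c u = 0 ->
    \sum_i c i = 0 /\ \sum_i c i * (-1) ^+ i = 0.
  have Pv : P m c v = (\sum_i c i) *: v.
    by rewrite scaler_suml; apply: eq_bigr => i _; rewrite hXv.
  have Pu : P m c u = (\sum_i c i * (-1) ^+ i) *: u.
    by rewrite scaler_suml; apply: eq_bigr => i _; rewrite hXu scalerA.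
  (* Applying [h] keeps the part along [v] and negates the part along [u]. *)
  move=> Pvu; have Pvu' : P m c v - P m c u = 0.
    have := congr1 (rho (h ^+ 1)%g) Pvu.
    by rewrite reprD // repr0 // Pv Pu !reprZ // hXv hXu expr1 scaleN1r scalerN.
  have [] := addr_subr_eq0 Pvu Pvu'; rewrite Pv Pu => /eqP + /eqP.
  by rewrite !scaler_eq0 (negPf v0) (negPf u0) !orbF => /eqP-> /eqP->.
have sK : <[(h ^+ 2)%g]>%G \subset <[h]>%g by rewrite cycle_subG mem_cycle.
have [Z1|] := pselect (forall x, rho (h ^+ 2)%g x = x).
  apply: (@cyclic_transfer _ _ _ U h _ 2 (v + u)) => //; first exact: cycle_id.
  move=> c; rewrite -/(P 2 c (v + u)) PD => /Puv[].
  rewrite !big_ord_recl !big_ord0 /= => c1 c2 i.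
  have [c0 c0'] : c ord0 = 0 /\ c (lift ord0 ord0) = 0 by split; lra.
  by case: i => -[|[|//]] lti; [rewrite -[RHS]c0 | rewrite -[RHS]c0'];
    congr c; apply: val_inj.
move=> /existsNP[x /eqP xZ].
have [s s0 h2s] : exists2 s, s != 0 & rho (h ^+ 2)%g s = - s.
  exists (x - rho (h ^+ 2)%g x); first by rewrite subr_eq0 eq_sym.
  by rewrite reprD // reprN // -repr_funM // -expgD h4 repr_fun1 opprB addrC.
apply: (@cyclic_transfer _ _ _ U h _ 4 (v + u + s)) => //.
- by rewrite h4 group1.
- by move=> y; rewrite h4 repr_fun1.
move=> c; rewrite -/(P 4 c (v + u + s)) PD => Pvus.
(* Now [h ^+ 2] separates [v + u], which it fixes, from [s], which it negates. *)
have [] := addr_subr_eq0 Pvus.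
  have := congr1 (rho (h ^+ 2)%g) Pvus.
  rewrite reprD // repr0 // -!PM h2s reprD // hXv hXu sqrrN expr1n scale1r.
  by rewrite -(scaleN1r s) PZ scaleN1r.
rewrite PD => /Puv[]; rewrite !big_ord_recl !big_ord0 /= => c1 c2 Ps.
(* Because h^2 s = -s, the combination acts on [s] as the complex number a + bi, with [h] as i;
   multiplying by a - bi gives a^2 + b^2 = 0. *)
pose a := c ord0 - c (lift ord0 (lift ord0 ord0)).
pose b := c (lift ord0 ord0) - c (lift ord0 (lift ord0 (lift ord0 ord0))).
have Es : a *: s + b *: rho h s = 0.
  rewrite -[RHS]Ps /P !big_ord_recl big_ord0 addr0 /= expg0 repr_fun1 expg1.
  rewrite -![bump _ _]/(_.+1) h2s expgS repr_funM // h2s reprN // !scalerN.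
  by rewrite addrA addrACA -!scalerBl.
have Ehs : a *: rho h s - b *: s = 0.
  have := congr1 (rho h) Es; rewrite reprD // repr0 // !reprZ // -repr_funM //.
  by rewrite -[(h * h)%g]/(h ^+ 2)%g h2s scalerN.
have ab : a ^+ 2 + b ^+ 2 = 0.
  have : (a ^+ 2 + b ^+ 2) *: s = a *: (a *: s + b *: rho h s)
      - b *: (a *: rho h s - b *: s).
    rewrite scalerDl scalerDr scalerBr !scalerA (mulrC b a) opprB.
    by rewrite [RHS]addrACA subrr addr0.
  rewrite Es Ehs !scaler0 subr0 => /eqP; rewrite scaler_eq0 (negPf s0) orbF.
  by move/eqP.
have /andP[/eqP a0 /eqP b0] : (a == 0) && (b == 0).
  by rewrite -(sqrf_eq0 a) -(sqrf_eq0 b) -paddr_eq0 ?sqr_ge0 // ab.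
have {}a0 : c ord0 = c (lift ord0 (lift ord0 ord0)).
  by apply/eqP; rewrite -subr_eq0 -/a a0.
have {}b0 : c (lift ord0 ord0) = c (lift ord0 (lift ord0 (lift ord0 ord0))).
  by apply/eqP; rewrite -subr_eq0 -/b b0.
have [c00 c01] : c ord0 = 0 /\ c (lift ord0 ord0) = 0.
  by move: c2; rewrite -![bump _ _]/(_.+1) !exprS expr0; split; lra.
case=> -[|[|[|[|//]]]] lti;
  [rewrite -[RHS]c00 | rewrite -[RHS]c01 | rewrite -[RHS]c00 a0
  | rewrite -[RHS]c01 b0]; by congr c; apply: val_inj.
Qed.

End SignTransfer.

(** Inducing a fixed vector [v] from the index-two subgroup [Z] yields the sign representation: the
    function equal to [v] on [Z] and to [- v] off [Z] is negated by [x], and an embedding carries it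
    to a non-zero vector of [U]. *)
Lemma transfer_sign_vector (R : realType) (gT : finGroupType) (G : {group gT})
    (U : universe R G) (x : gT) :
    #[x]%g = 4%N ->
    isometries_transfer U <[(x ^+ 2)%g]>%G <[x]>%G ->
  exists2 w : U, w != 0 & univ_repr U x w = - w.
Proof.
move=> ox [sZX [sXG [f [inj_f fE]]]].
have [v v0 fixv] := universe_fixed U.
set Z := <[(x ^+ 2)%g]>%G in sZX f inj_f fE.
pose phi0 := [ffun g : subg_of <[x]>%G => if sgval g \in Z then v else - v].
have phiP : phi0 \in ind_pred
    (res_repr (subset_trans sZX sXG) (univ_repr U)).
  apply/ind_predP=> g k kZ; rewrite !ffunE /= groupMr //.
  have kG : (sgval k)^-1%g \in G.
    by rewrite groupV (subsetP (subset_trans sZX sXG)).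
  by case: ifP; rewrite ?reprN ?fixv.
pose phi := IndType phiP.
have xX : x \in <[x]>%g by exact: cycle_id.
exists (f phi).
  rewrite -(linear0 f) (inj_eq inj_f); apply: contra v0 => /eqP phi_0.
  have := congr1 (fun p : ind_type _ _ => val p 1%g) phi_0.
  by rewrite /= !ffunE group1 => ->.
rewrite -[LHS](fE x xX phi) -linearN; congr (f _); apply: val_inj.
apply/ffunP=> g; rewrite !ffunE /= subgK //.
have xZ : x \notin Z.
  apply/negP; rewrite -cycle_subG => /subset_leq_card.
  by rewrite -!orderE orderXdiv ox.
have [gZ | gZ] := boolP (sgval g \in Z).
  by rewrite groupMr // groupV (negPf xZ).
(* Outside [Z] the exponent [k] is odd, so multiplying by x^-1 leads back into [Z]. *)
have /cycleP[k gk] := subgP g.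
suff -> : (x^-1 * sgval g)%g \in Z by rewrite opprK.
rewrite gk in gZ *; have := odd_double_half k; case: odd => [|k2].
  by rewrite add1n => <-; rewrite expgS mulKg -mul2n expgM mem_cycle.
by case/negP: gZ; rewrite -k2 add0n -mul2n expgM mem_cycle.
Qed.

(** * The saturated transfer system with one non-trivial transfer *)

Section QuaternionTransfer.
Variables (gT : finGroupType) (G : {group gT}) (x : gT).
Hypotheses (nG : forall H : {group gT}, H \subset G -> (H <| G)%g).
Hypothesis ox : #[x]%g = 4%N.

Definition square_transfer (K H : {group gT}) : Prop :=
  K = H \/ K = <[(x ^+ 2)%g]>%G /\ H = <[x]>%G.

Lemma square_subcycle (K : {group gT}) :
  K \subset <[x]>%g -> K = <[x]>%G \/ K \subset <[(x ^+ 2)%g]>%g.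
Proof.
move=> sKX; have := cardSg sKX; rewrite -[#|<[x]>%g|]/(#[x]%g) ox => K4.
have [K4' | nK4] := eqVneq #|K| 4%N.
  by left; apply/val_inj/eqP; rewrite eqEcard sKX K4' /= -orderE ox.
right; rewrite -(cardSg_cyclic (cycle_cyclic x)) ?cycle_subG ?mem_cycle //.
rewrite -orderE orderXdiv ox // (_ : 4 %/ 2 = 2)%N //.
have : (#|K| <= 4)%N by exact: dvdn_leq K4.
by case: #|K| K4 nK4 => [|[|[|[|[|]]]]].
Qed.

(** Restricting the non-trivial transfer to a proper subgroup of [<[x]>], which lies in [Z], gives a
    reflexive one; conjugation acts trivially since all subgroups are normal. *)
Lemma square_transfer_system : transfer_system G square_transfer.
Proof.
have sZX : <[(x ^+ 2)%g]>%g \subset <[x]>%g by rewrite cycle_subG mem_cycle.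
split.
- by left.
- by move=> H K _ _ [-> //|[-> ->]] [-> //|[-> _]].
- by move=> K H L _ _ _ [-> //|[-> ->]] [<-|[_ ->]]; right.
- by move=> K H _ _ [-> //|[-> ->]].
- move=> L H K _ _ _ [-> sKH|[-> -> sKX]].
    by left; apply: val_inj; apply/setIidPl.
  have [->|sKZ] := square_subcycle sKX.
    by right; split=> //; apply: val_inj; apply/setIidPr.
  by left; apply: val_inj; apply/setIidPl.
move=> K H g sKG sHG gG.
have conjE (L : {group gT}) : L \subset G -> (L :^ g^-1)%G = L.
  move=> /nG/andP[_ /subsetP nL]; apply: val_inj; apply: normP.
  by rewrite nL ?groupV.
by rewrite !conjE.
Qed.

Lemma square_transfer_saturated : saturated_transfer G square_transfer.
Proof.
move=> L K H sLK sKH _ [eLH|[eLZ eHX]].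
  by left; apply: val_inj; apply/eqP; rewrite eqEsubset sKH -eLH sLK.
rewrite eHX in sKH *; have [->|sKZ] := square_subcycle sKH; first by left.
right; split=> //; apply: val_inj; apply/eqP.
by rewrite eqEsubset sKZ; rewrite eLZ in sLK.
Qed.

End QuaternionTransfer.

Theorem theorem5 (R : realType) (gT : finGroupType) (G : {group gT})
    (hG : hamiltonian G) : ~ saturated_group R G.
Proof.
have [x [y [xG yG ox y2 xy]]] := hamiltonian_quaternion hG.
have nG := hG.2; have x4 : (x ^+ 4 = 1)%g by rewrite -ox expg_order.
have xXG i : (x ^+ i)%g \in G by rewrite groupX.
move=> /(_ _ (square_transfer_system nG ox)).
move=> /(_ (square_transfer_saturated ox))[U TU].
have sZG : <[(x ^+ 2)%g]>%G \subset G by rewrite cycle_subG.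
have sXG : <[x]>%G \subset G by rewrite cycle_subG.
have [w w0 xw] := transfer_sign_vector ox
  ((TU _ _ sZG sXG).1 (or_intror (conj erefl erefl))).
(* A sign vector for [h] gives a transfer from [Z] to [<[h]>], so [<[h]>] is [Z] or [<[x]>] and [h]
   lies in [<[x]>]. Then so does [y], contradicting [x, y] = x^2, which is not 1. *)
have absurd h u : h \in G -> (h ^+ 2 = x ^+ 2)%g ->
    (h \in <[x]> -> y \in <[x]>)%g ->
    u != 0 -> univ_repr U h u = - u -> False.
  move=> hinG h2 hy u0 hu.
  have sHG : <[h]>%G \subset G by rewrite cycle_subG.
  have h4 : (h ^+ 4 = 1)%g by rewrite (expgM h 2 2) h2 -expgM.
  have := sign_transfer hinG h4 u0 hu; rewrite h2 => /(TU _ _ sZG sHG) TZH.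
  have : y \in <[x]>%g.
    apply: hy; have := cycle_id h; case: TZH => [[<-]|[_ [->]]] //.
    by apply: subsetP; rewrite cycle_subG mem_cycle.
  move/commute_cycle/commute_sym/commgP; rewrite xy -order_dvdn ox.
  by [].
have yyw : univ_repr U y (univ_repr U y w) = w.
  rewrite -repr_funM // -[(y * y)%g]/(y ^+ 2)%g y2 repr_funM //.
  by rewrite !xw reprN // xw opprK.
pose u := w + univ_repr U y w.
have [u0|u0] := eqVneq u 0.
  apply: (absurd y w) => //; apply/eqP; rewrite -addr_eq0 addrC.
  exact/eqP.
have xyE : (x * y = y * (x * x ^+ 2))%g.
  by rewrite mulgA commgC xy.
apply: (absurd (x * y)%g u) => //.
- exact: groupM.
(* (xy)^2 = y x^3 x y = y^2 = x^2. *)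
- rewrite -[LHS]/(x * y * (x * y))%g [X in (X * _)%g]xyE -expgS.
  by rewrite mulgA -(mulgA y) -expgSr x4 mulg1 -y2.
- by rewrite groupMl // cycle_id.
(* The term y w is sent by xy to x y^2 w = x w = -w, and [w] to y x^3 w = -y w. *)
rewrite repr_funM // /u reprD // yyw reprD // xw opprD addrC; congr (_ + _).
rewrite -repr_funM // xyE repr_funM ?groupM // repr_funM //.
rewrite -[(x ^+ 2)%g]/(x * x)%g repr_funM // xw reprN // xw opprK xw.
by rewrite reprN.
Qed.
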